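(* Let $\Gamma$ be an inverse semigroup. The map $J:G_u(\Gamma)\to H_u(\Gamma)$, $J(X)=[XX^{-1},x]$ with an arbitrary $x\in\Gamma$ satisfying $X\prec x$, is an isomorphism of topological groupoids, with inverse map $K:H_u(\Gamma)\to G_u(\Gamma)$ given by $K([P,x])=Px$.
   Context: In an inverse semigroup, $x\prec y$ means $xy^{-1}=xx^{-1}$ (natural partial order), and for an inverse semigroup $S$, $S^{(0)}$ is its set of idempotents. A subset $A\subset\Gamma$ is directed if it is nonempty and any two elements of $A$ have a common $\prec$-lower bound in $A$. For directed sets write $A\prec B$ if for every $b\in B$ there is $a\in A$ with $a\prec b$, and $A\sim B$ if $A\prec B$ and $B\prec A$. $\mathcal{O}(\Gamma)$ is the set of $\sim$-classes $[A]$ of directed sets; with $[A][B]=[AB]$ and $[A]^{-1}=[A^{-1}]$ (elementwise) it is an inverse semigroup whose natural order is $[A]\prec[B]\iff A\prec B$. For $x\in\Gamma$ write $x$ also for $[\{x\}]$, so products such as $Px$ and $x^{-1}Px$ are taken in $\mathcal{O}(\Gamma)$. $G_u(\Gamma)$ is the groupoid with underlying set $\mathcal{O}(\Gamma)$, the inversion of $\mathcal{O}(\Gamma)$, and product $XY$ defined iff $X^{-1}X=YY^{-1}$. For $x\in\Gamma$, $U_x=\{X:X\prec x\}$; for $x_1,\ldots,x_n\prec x$ ($n\ge0$), $U_{x;x_1,\ldots,x_n}=U_x\cap U_{x_1}^c\cap\cdots\cap U_{x_n}^c$. These sets form a basis of the topology of $G_u(\Gamma)$. $H_u(\Gamma)$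 (Paterson's universal groupoid, with the space of semicharacters identified with $\mathcal{O}(\Gamma)^{(0)}$) consists of the equivalence classes $[P,x]$ of pairs $(P,x)$ with $P\in\mathcal{O}(\Gamma)^{(0)}$, $x\in\Gamma$, $P\prec xx^{-1}$, where $(P,x)$ and $(\widetilde P,\widetilde x)$ are identified if $P=\widetilde P$ and there is $p\in\Gamma$ with $P\prec p$ and $px=p\widetilde x$. The involution is $[P,x]^{*}=[x^{-1}Px,x^{-1}]$, and the multiplication is $[P,x]*[x^{-1}Px,y]=[P,xy]$. A basis of its topology is given by the sets $\{[P,x]:P\in U_{p;p_1,\ldots,p_n}\}$ with $x\in\Gamma$ and $p_1,\ldots,p_n\prec p$ in $\Gamma^{(0)}$, $p\prec xx^{-1}$. *)

(* Defs.v *)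
Set Warnings "-notation-overridden,-notation-incompatible-prefix,-redundant-canonical-projection".
From HB Require Import structures.
From mathcomp Require Import all_boot.
From mathcomp Require Import all_classical.
From mathcomp Require Import topology.

Set Implicit Arguments.
Unset Strict Implicit.
Unset Printing Implicit Defensive.

Local Open Scope classical_set_scope.
Local Open Scope quotient_scope.
Local Open Scope group_scope.

(* Library semigroups carry a choiceType structure, which every type has
   classically. *)
HB.mixin Record Semigroup_isInverseSemigroup S of monoid.Semigroup S := {
  invs : S -> S;
  mulKVs : forall x : S, x * invs x * x = x;
  mulVKs : forall x : S, invs x * x * invs x = invs x;
  invs_unique : forall x y : S, x * y * x = x -> y * x * y = y -> y = invs x
}.

#[short(type="invSemigroupType")]
HB.structure Definition InverseSemigroup :=
  {S of Semigroup_isInverseSemigroup S & monoid.Semigroup S}.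

(* Overrides the library's x^-1, which is tied to types with a unit. *)
Notation "x ^-1" := (invs x) : group_scope.

Definition idem (S : invSemigroupType) : set S := [set e | e * e = e].

Definition sprec (S : invSemigroupType) (x y : S) : Prop :=
  x * y^-1 = x * x^-1.

Notation "x ≺ y" := (sprec x y) (at level 70, no associativity) : group_scope.

Section InverseSemigroupTheory.
Variable S : invSemigroupType.
Implicit Types x y z e f : S.

Let mA := @monoid.mulgA S.

Lemma invsK x : x^-1^-1 = x.
Proof. by apply/esym/invs_unique; [exact: mulVKs|exact: mulKVs]. Qed.

Lemma idem_inv e : idem e -> e^-1 = e.
Proof. by move=> ee; apply/esym/invs_unique; rewrite !ee. Qed.

Lemma idemM e f : idem e -> idem f -> idem (e * f).
Proof.
move=> ee ff; set a := (e * f)^-1.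
have Ha : f * a * e = a.
  apply: invs_unique.
    transitivity (e * (f * f) * a * (e * e) * f); first by rewrite !mA.
    by rewrite ee ff -(mA _ e f) mulKVs.
  transitivity (f * a * (e * e) * (f * f) * a * e); first by rewrite !mA.
  rewrite ee ff; transitivity (f * (a * (e * f) * a) * e); first by rewrite !mA.
  by rewrite mulVKs.
have aa : idem a.
  rewrite /idem /= -{1 2}Ha.
  transitivity (f * (a * (e * f) * a) * e); first by rewrite !mA.
  by rewrite mulVKs.
by have := idem_inv aa; rewrite invsK => ->.
Qed.

Lemma idemC e f : idem e -> idem f -> e * f = f * e.
Proof.
move=> ee ff; have ef := idemM ee ff; have fe := idemM ff ee.
rewrite -(idem_inv ef); apply/esym/invs_unique.
  transitivity (e * (f * f) * (e * e) * f); first by rewrite !mA.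
  by rewrite ee ff -(mA _ e f) ef.
transitivity (f * (e * e) * (f * f) * e); first by rewrite !mA.
by rewrite ee ff -(mA _ f e) fe.
Qed.

Lemma idem_mulV x : idem (x * x^-1).
Proof. by rewrite /idem /= mA mulKVs. Qed.

Lemma idem_Vmul x : idem (x^-1 * x).
Proof. by rewrite /idem /= mA mulVKs. Qed.

Lemma invsM x y : (x * y)^-1 = y^-1 * x^-1.
Proof.
have C := idemC (idem_mulV y) (idem_Vmul x).
apply/esym/invs_unique.
  transitivity (x * ((y * y^-1) * (x^-1 * x)) * y); first by rewrite !mA.
  by rewrite C !mA mulKVs -!mA (mA y) mulKVs.
transitivity (y^-1 * ((x^-1 * x) * (y * y^-1)) * x^-1); first by rewrite !mA.
by rewrite -C !mA mulVKs -!mA (mA x^-1) mulVKs.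
Qed.

Lemma idem_conj x e : idem e -> idem (x * e * x^-1).
Proof.
move=> ee; rewrite /idem /=.
transitivity (x * (e * (x^-1 * x)) * e * x^-1); first by rewrite !mA.
rewrite (idemC ee (idem_Vmul x)) !mA mulKVs.
by rewrite -(mA x e e) ee.
Qed.

Lemma idem_conjV x e : idem e -> idem (x^-1 * e * x).
Proof. by move=> /(@idem_conj x^-1); rewrite invsK. Qed.

Lemma sprecE_r x y f : idem f -> x = y * f -> x ≺ y.
Proof.
move=> ff ->; rewrite /sprec invsM (idem_inv ff) !mA.
by rewrite -(mA y f f) ff.
Qed.

Lemma sprecP x y : x ≺ y <-> x = y * (x^-1 * x).
Proof.
split=> [h|h]; last by apply: sprecE_r h; exact: idem_Vmul.
have := congr1 (@invs S) h; rewrite !invsM !invsK => h'.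
by rewrite mA h' mulKVs.
Qed.

Lemma mul_idem_r x e : idem e -> x * e = (x * e * x^-1) * x.
Proof.
move=> ee; rewrite -!mA (idemC ee (idem_Vmul x)) !mA.
by rewrite mulKVs.
Qed.

Lemma mul_idem_l x e : idem e -> e * x = x * (x^-1 * e * x).
Proof.
move=> ee; rewrite !mA -(idemC ee (idem_mulV x)) -!mA.
by rewrite (mA x) mulKVs.
Qed.

Lemma sprecE_l x y e : idem e -> x = e * y -> x ≺ y.
Proof.
move=> ee ->; apply: (@sprecE_r _ _ (y^-1 * e * y)); first exact: idem_conjV.
by rewrite -mul_idem_l.
Qed.

Lemma sprec_l x y : x ≺ y <-> x = x * x^-1 * y.
Proof.
split=> [/sprecP h|h]; last by apply: sprecE_l h; exact: idem_mulV.
have ff := idem_Vmul x; move: (x^-1 * x) h ff => f -> ff.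
by rewrite invsM (idem_inv ff) !mA -(mA y f f) ff -mul_idem_r.
Qed.

Lemma sprec_refl x : x ≺ x. Proof. by []. Qed.

Lemma sprec_trans y x z : x ≺ y -> y ≺ z -> x ≺ z.
Proof.
move=> /sprecP xy /sprecP yz.
apply: (@sprecE_r _ _ ((y^-1 * y) * (x^-1 * x))).
  by apply: idemM; exact: idem_Vmul.
by rewrite (mA z) -yz.
Qed.

Lemma sprec_antisym x y : x ≺ y -> y ≺ x -> x = y.
Proof.
move=> /sprecP xy /sprecP yx.
have C := idemC (idem_Vmul x) (idem_Vmul y).
rewrite xy {1}yx -mA -C.
by rewrite (mA x) (mA x) mulKVs -yx.
Qed.

Lemma sprecM x x' y y' : x ≺ x' -> y ≺ y' -> x * y ≺ x' * y'.
Proof.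
move=> /sprecP hx /sprecP hy.
apply: (@sprecE_r _ _ ((y'^-1 * (x^-1 * x) * y') * (y^-1 * y))).
  by apply: idemM; [apply: idem_conjV|]; exact: idem_Vmul.
have h := mul_idem_l y' (idem_Vmul x).
rewrite {1}hx {1}hy; move: (x^-1 * x) (y^-1 * y) h => e f h.
transitivity (x' * (e * y') * f); first by rewrite !mA.
by rewrite h !mA.
Qed.

Lemma sprecV x y : x ≺ y -> x^-1 ≺ y^-1.
Proof.
move=> /sprec_l h; apply: (@sprecE_r _ _ (x * x^-1)); first exact: idem_mulV.
by rewrite {1}h invsM (idem_inv (idem_mulV x)).
Qed.

Lemma sprec_idem x e : x ≺ e -> idem e -> idem x.
Proof.
move=> /sprecP -> ee.
by apply: idemM => //; exact: idem_Vmul.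
Qed.

Lemma sprec_mull e x : idem e -> e * x ≺ x.
Proof. by move=> ee; exact: sprecE_l ee _. Qed.

Lemma sprec_mulr e x : idem e -> x * e ≺ x.
Proof. by move=> ee; exact: sprecE_r ee _. Qed.

Lemma sprec_idemP e f : idem e -> idem f -> e ≺ f <-> e * f = e.
Proof. by move=> ee ff; rewrite /sprec !idem_inv // ee. Qed.

Lemma sprec_mulV x y : x ≺ y -> x * x^-1 ≺ y * y^-1.
Proof. by move=> xy; apply: sprecM => //; exact: sprecV. Qed.

Lemma sprec_Vmul x y : x ≺ y -> x^-1 * x ≺ y^-1 * y.
Proof. by move=> xy; apply: sprecM => //; exact: sprecV. Qed.

Lemma sprec_meet e f g : idem e -> g ≺ e -> g ≺ f -> g ≺ e * f.
Proof.
move=> ee ge gf; have gg := sprec_idem ge ee.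
by rewrite -[g]gg; exact: sprecM.
Qed.

End InverseSemigroupTheory.

Lemma invs_unique_of_idemC (T : monoid.Semigroup.type) :
  (forall e f : T, e * e = e -> f * f = f -> e * f = f * e) ->
  forall x y z : T, x * y * x = x -> y * x * y = y ->
    x * z * x = x -> z * x * z = z -> y = z.
Proof.
move=> C x y z xy yx xz zx; have mA := @monoid.mulgA T.
have e1 : (x * y) * (x * y) = x * y by rewrite mA xy.
have e2 : (x * z) * (x * z) = x * z by rewrite mA xz.
have e3 : (y * x) * (y * x) = y * x by rewrite mA yx.
have e4 : (z * x) * (z * x) = z * x by rewrite mA zx.
transitivity (y * x * z).
  rewrite -{1}yx -{1}xz; transitivity (y * ((x * z) * (x * y))).
    by rewrite !mA.
  by rewrite (C _ _ e2 e1) !mA yx.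
rewrite -{2}zx -{2}xy; transitivity (((z * x) * (y * x)) * z).
  by rewrite (C _ _ e4 e3) -!mA (mA x z) (mA (x * z)) xz.
by rewrite !mA.
Qed.

Section DirectedSets.
Variable S : invSemigroupType.
Implicit Types A B C : set S.

Definition directed A : Prop :=
  A !=set0 /\
  forall a b, A a -> A b -> exists c, [/\ A c, c ≺ a & c ≺ b].

Definition dprec A B : Prop := forall b, B b -> exists2 a, A a & a ≺ b.

Definition dsim A B : Prop := dprec A B /\ dprec B A.

Record directed_set := DirectedSet { dset :> set S; dsetP : directed dset }.

HB.instance Definition _ := gen_eqMixin directed_set.
HB.instance Definition _ := gen_choiceMixin directed_set.

Definition setM A B : set S := [set a * b | a in A & b in B].
Definition setV A : set S := [set a^-1 | a in A].

Lemma directed1 x : directed [set x].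
Proof.
by split; [exists x | move=> a b -> ->; exists x; split].
Qed.

Lemma directedM A B : directed A -> directed B -> directed (setM A B).
Proof.
move=> [[a Aa] dA] [[b Bb] dB]; split; first by exists (a * b); exists a => //; exists b.
move=> _ _ [a1 Aa1 [b1 Bb1 <-]] [a2 Aa2 [b2 Bb2 <-]].
have [a' [Aa' h1 h2]] := dA _ _ Aa1 Aa2.
have [b' [Bb' h3 h4]] := dB _ _ Bb1 Bb2.
exists (a' * b'); split; [|exact: sprecM|exact: sprecM].
by exists a' => //; exists b'.
Qed.

Lemma directedV A : directed A -> directed (setV A).
Proof.
move=> [[a Aa] dA]; split; first by exists a^-1; exists a.
move=> _ _ [a1 Aa1 <-] [a2 Aa2 <-].
have [a' [Aa' h1 h2]] := dA _ _ Aa1 Aa2.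
by exists a'^-1; split; [exists a'|exact: sprecV|exact: sprecV].
Qed.

Definition dset1 (x : S) := DirectedSet (directed1 x).
Definition dsetM (A B : directed_set) :=
  DirectedSet (directedM (dsetP A) (dsetP B)).
Definition dsetV (A : directed_set) := DirectedSet (directedV (dsetP A)).

Lemma dprec_refl A : dprec A A.
Proof. by move=> a Aa; exists a. Qed.

Lemma dprec_trans B A C : dprec A B -> dprec B C -> dprec A C.
Proof.
move=> AB BC c /BC[b /AB[a Aa ab] bc].
by exists a => //; exact: sprec_trans ab bc.
Qed.

Definition dsimb (A B : directed_set) : bool := `[< dsim A B >].

Lemma dsimb_refl : reflexive dsimb.
Proof. by move=> A; apply/asboolP; split; exact: dprec_refl. Qed.

Lemma dsimb_sym : symmetric dsimb.
Proof. by move=> A B; apply/asboolP/asboolP => -[]. Qed.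

Lemma dsimb_trans : transitive dsimb.
Proof.
move=> B A C /asboolP[AB BA] /asboolP[BC CB]; apply/asboolP.
by split; apply: dprec_trans; eauto.
Qed.

Canonical dsim_equiv := EquivRel dsimb dsimb_refl dsimb_sym dsimb_trans.

Definition dclasses := {eq_quot dsim_equiv}.
HB.instance Definition _ := Choice.on dclasses.
HB.instance Definition _ := EqQuotient.on dclasses.

Definition dcls (A : directed_set) : dclasses := \pi_dclasses A.

Lemma dcls_eq (A B : directed_set) : dcls A = dcls B <-> dsim A B.
Proof.
split=> [/eqmodP/asboolP//|h]; apply/eqmodP/asboolP; exact: h.
Qed.

Lemma dclsP (X : dclasses) : exists A : directed_set, X = dcls A.
Proof. by exists (repr X); rewrite /dcls reprK. Qed.

(* dclsM_dcls and dclsV_dcls below: these are independent of the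
   representatives. *)
Definition dclsM (X Y : dclasses) : dclasses := dcls (dsetM (repr X) (repr Y)).
Definition dclsV (X : dclasses) : dclasses := dcls (dsetV (repr X)).

Lemma dprecM A A' B B' : dprec A A' -> dprec B B' ->
  dprec (setM A B) (setM A' B').
Proof.
move=> AA BB _ [a' /AA[a Aa aa] [b' /BB[b Bb bb] <-]].
by exists (a * b); [exists a => //; exists b|exact: sprecM].
Qed.

Lemma dprecV A A' : dprec A A' -> dprec (setV A) (setV A').
Proof.
move=> AA _ [a' /AA[a Aa aa] <-].
by exists a^-1; [exists a|exact: sprecV].
Qed.

Lemma repr_dcls (A : directed_set) : dsim (repr (dcls A)) A.
Proof. by apply/dcls_eq; rewrite /dcls reprK. Qed.

Lemma dclsM_dcls (A B : directed_set) :
  dclsM (dcls A) (dcls B) = dcls (dsetM A B).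
Proof.
have [A1 A2] := repr_dcls A; have [B1 B2] := repr_dcls B.
by apply/dcls_eq; split; apply: dprecM.
Qed.

Lemma dclsV_dcls (A : directed_set) : dclsV (dcls A) = dcls (dsetV A).
Proof.
have [A1 A2] := repr_dcls A.
by apply/dcls_eq; split; apply: dprecV.
Qed.

Lemma dclsM_assoc : associative dclsM.
Proof.
move=> X Y Z; have [A ->] := dclsP X; have [B ->] := dclsP Y.
have [C ->] := dclsP Z; rewrite !dclsM_dcls; apply/dcls_eq; split.
  move=> _ [_ [a Aa [b Bb <-]] [c Cc <-]].
  exists (a * (b * c)); last by rewrite monoid.mulgA.
  by exists a => //; exists (b * c) => //; exists b => //; exists c.
move=> _ [a Aa [_ [b Bb [c Cc <-]] <-]].
exists (a * b * c); last by rewrite monoid.mulgA.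
by exists (a * b); [exists a => //; exists b|exists c].
Qed.

HB.instance Definition _ := monoid.isSemigroup.Build dclasses dclsM_assoc.

Lemma dcls_mul (A B : directed_set) : dcls A * dcls B = dcls (dsetM A B).
Proof. exact: dclsM_dcls. Qed.

Lemma idem_dclsP (A : directed_set) : dcls A * dcls A = dcls A <->
  forall a, dset A a -> exists e, [/\ dset A e, idem e & e ≺ a].
Proof.
rewrite dcls_mul dcls_eq; have [_ dA] := dsetP A; split=> [[h1 h2] a Aa|h].
  have [_ [b Ab [c Ac <-]] bca] := h1 _ Aa.
  have [d [Ad db dc]] := dA _ _ Ab Ac.
  have [d' [Ad' dd da]] := dA _ _ Ad Aa.
  have Add : setM A A (d' * d') by exists d' => //; exists d'.
  have [e0 Ae0 e0d] := h2 _ Add.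
  have [e [Ae ee0 ed]] := dA _ _ Ae0 Ad'.
  exists e; split=> //; last exact: sprec_trans ed da.
  have edd : e ≺ d' * d' := sprec_trans ee0 e0d.
  have k3 := (sprec_l e d').1 ed.
  have k4 := (sprec_l e (d' * d')).1 edd.
  have k5 : e = e * d' by rewrite {1}k4 monoid.mulgA -k3.
  have k6 := (sprecP e d').1 ed.
  rewrite /idem /= {2}k6 monoid.mulgA -k5.
  by rewrite monoid.mulgA mulKVs.
split=> [a /h[e [Ae ee ea]]|_ [a Aa [b Ab <-]]].
  by exists (e * e); [exists e => //; exists e|rewrite ee].
have [c [Ac ca cb]] := dA _ _ Aa Ab.
have [e [Ae ee ec]] := h _ Ac.
by exists e => //; rewrite -[e]ee; apply: sprecM; exact: sprec_trans ec _.
Qed.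

Lemma dcls_idemC (X Y : dclasses) : X * X = X -> Y * Y = Y -> X * Y = Y * X.
Proof.
have [A ->] := dclsP X; have [B ->] := dclsP Y.
move=> /idem_dclsP hA /idem_dclsP hB; rewrite !dcls_mul; apply/dcls_eq; split.
  move=> _ [b /hB[f [Bf ff fb]] [a /hA[e [Ae ee ea]] <-]].
  exists (e * f); first by exists e => //; exists f.
  by rewrite idemC //; exact: sprecM.
move=> _ [a /hA[e [Ae ee ea]] [b /hB[f [Bf ff fb]] <-]].
exists (f * e); first by exists f => //; exists e.
by rewrite idemC //; exact: sprecM.
Qed.

Lemma dcls_mulKVs (X : dclasses) : X * dclsV X * X = X.
Proof.
have [A ->] := dclsP X; rewrite dclsV_dcls !dcls_mul; apply/dcls_eq.
have [_ dA] := dsetP A; split=> [a Aa|].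
  exists (a * a^-1 * a); last by rewrite mulKVs.
  exists (a * a^-1); last by exists a.
  by exists a => //; exists a^-1 => //; exists a.
move=> _ [_ [a Aa [_ [b Ab <-] <-]] [c Ac <-]].
have [d [Ad da db]] := dA _ _ Aa Ab; have [e [Ae ed ec]] := dA _ _ Ad Ac.
exists e => //; rewrite -{1}[e]mulKVs; apply: sprecM => //.
by apply: sprecM; [|apply: sprecV]; apply: sprec_trans ed _.
Qed.

Lemma dcls_VK (X : dclasses) : dclsV (dclsV X) = X.
Proof.
have [A ->] := dclsP X; rewrite !dclsV_dcls; apply/dcls_eq; split.
  by move=> a Aa; exists a => //; exists a^-1; [exists a|rewrite invsK].
by move=> _ [_ [a Aa <-] <-]; exists a => //; rewrite invsK.
Qed.

Lemma dcls_mulVKs (X : dclasses) : dclsV X * X * dclsV X = dclsV X.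
Proof. by have := dcls_mulKVs (dclsV X); rewrite dcls_VK. Qed.

Lemma dcls_inv_unique (X Y : dclasses) :
  X * Y * X = X -> Y * X * Y = Y -> Y = dclsV X.
Proof.
move=> h1 h2; apply: (invs_unique_of_idemC dcls_idemC h1 h2).
  exact: dcls_mulKVs.
exact: dcls_mulVKs.
Qed.

HB.instance Definition _ := Semigroup_isInverseSemigroup.Build dclasses
  dcls_mulKVs dcls_mulVKs dcls_inv_unique.

Lemma dcls_inv (A : directed_set) : (dcls A)^-1 = dcls (dsetV A).
Proof. exact: dclsV_dcls. Qed.

Lemma dcls_sprec (A B : directed_set) : dcls A ≺ dcls B <-> dprec A B.
Proof.
have [[a0 Aa0] dA] := dsetP A; have [[b0 Bb0] dB] := dsetP B.
split=> [|AB].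
  move=> /sprecP; rewrite dcls_inv (dcls_mul (dsetV A)) dcls_mul => /dcls_eq[AB _] b Bb.
  have [|c Ac cb] := AB (b * (a0^-1 * a0)).
    exists b => //; exists (a0^-1 * a0) => //.
    by exists a0^-1; [exists a0|exists a0].
  exists c => //.
  by apply: sprec_trans cb _; apply: sprec_mulr; exact: idem_Vmul.
apply/sprecP; rewrite dcls_inv (dcls_mul (dsetV A)) dcls_mul; apply/dcls_eq; split.
  move=> _ [b /AB[a Aa ab] [_ [_ [a1 Aa1 <-] [a2 Aa2 <-]] <-]].
  have [d [Ad da da1]] := dA _ _ Aa Aa1; have [e [Ae ed ea2]] := dA _ _ Ad Aa2.
  exists e => //; rewrite -{1}[e]mulKVs -monoid.mulgA; apply: sprecM.
    by apply: sprec_trans ed _; exact: sprec_trans da ab.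
  by apply: sprecM => //; apply: sprecV; exact: sprec_trans ed _.
move=> a Aa; have [a1 Aa1 a1b] := AB _ Bb0.
have [d [Ad da da1]] := dA _ _ Aa Aa1.
have db : d ≺ b0 := sprec_trans da1 a1b.
exists (b0 * (d^-1 * d)); last by rewrite -(sprecP _ _).1.
exists b0 => //; exists (d^-1 * d) => //.
by exists d^-1; [exists d|exists d].
Qed.

(* The identification of x with the class of {x}. *)
Definition emb (x : S) : dclasses := dcls (dset1 x).

Lemma emb_prec (x y : S) : emb x ≺ emb y <-> x ≺ y.
Proof.
rewrite dcls_sprec; split=> [/(_ y erefl)[_ -> //]|xy _ ->].
by exists x.
Qed.

Lemma embM (x y : S) : emb x * emb y = emb (x * y).
Proof.
rewrite dcls_mul; apply/dcls_eq; split=> [_ ->|_ [_ -> [_ -> <-]]].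
  by exists (x * y) => //; exists x => //; exists y.
by exists (x * y).
Qed.

Lemma embV (x : S) : (emb x)^-1 = emb x^-1.
Proof.
rewrite dcls_inv; apply/dcls_eq; split=> [_ ->|_ [_ -> <-]].
  by exists x^-1 => //; exists x.
by exists x^-1.
Qed.

Lemma emb_idem (e : S) : idem e -> idem (emb e).
Proof. by move=> ee; rewrite /idem /= embM ee. Qed.

Lemma prec_emb (A : directed_set) x :
  dcls A ≺ emb x <-> exists2 a, dset A a & a ≺ x.
Proof.
rewrite dcls_sprec; split=> [/(_ x erefl)//|h _ ->]; exact: h.
Qed.

Lemma ex_prec_emb (X : dclasses) : exists x, X ≺ emb x.
Proof.
have [A ->] := dclsP X; have [[a Aa] _] := dsetP A; exists a.
by apply/prec_emb; exists a.
Qed.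

Lemma prec_emb_dir (X : dclasses) x y : X ≺ emb x -> X ≺ emb y ->
  exists z, [/\ X ≺ emb z, z ≺ x & z ≺ y].
Proof.
have [A ->] := dclsP X; have [_ dA] := dsetP A.
move=> /prec_emb[a Aa ax] /prec_emb[b Ab bx].
have [c [Ac ca cb]] := dA _ _ Aa Ab; exists c.
split; [by apply/prec_emb; exists c|exact: sprec_trans ca ax|].
exact: sprec_trans cb bx.
Qed.

Lemma prec_embM (X Y : dclasses) z : X * Y ≺ emb z ->
  exists x y, [/\ X ≺ emb x, Y ≺ emb y & x * y ≺ z].
Proof.
have [A ->] := dclsP X; have [B ->] := dclsP Y.
rewrite dcls_mul => /prec_emb[_ [a Aa [b Bb <-]] abz]; exists a, b.
by split=> //; apply/prec_emb; [exists a|exists b].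
Qed.

Lemma prec_emb_idem (P : dclasses) p : idem P -> P ≺ emb p ->
  exists q, [/\ idem q, P ≺ emb q & q ≺ p].
Proof.
have [A ->] := dclsP P => /idem_dclsP h /prec_emb[a /h[e [Ae ee ea]] ap].
exists e; split=> //; last exact: sprec_trans ea ap.
by apply/prec_emb; exists e.
Qed.

End DirectedSets.

(* A groupoid in the sense of partially defined products; only the values of
   [gmul] at composable pairs are constrained. *)
HB.mixin Record isGroupoid G := {
  composable : G -> G -> Prop;
  gmul : G -> G -> G;
  ginv : G -> G;
  ginvK : forall a, ginv (ginv a) = a;
  gmulA : forall a b c, composable a b -> composable b c ->
    [/\ composable (gmul a b) c, composable a (gmul b c) &
        gmul (gmul a b) c = gmul a (gmul b c)];
  composableV : forall a, composable (ginv a) a;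
  gmulKV : forall a b, composable a b -> gmul (ginv a) (gmul a b) = b;
  gmulVK : forall a b, composable a b -> gmul (gmul a b) (ginv b) = a
}.

#[short(type="groupoidType")]
HB.structure Definition Groupoid := {G of isGroupoid G}.

HB.mixin Record Groupoid_isTopological G of Groupoid G & Topological G := {
  ginv_continuous : continuous (@ginv G);
  gmul_continuous :
    {within [set p : G * G | composable p.1 p.2],
      continuous (fun p => gmul p.1 p.2)}
}.

#[short(type="topGroupoidType")]
HB.structure Definition TopGroupoid :=
  {G of Groupoid_isTopological G & Groupoid G & Topological G}.

Section UniversalGroupoids.
Variable S : invSemigroupType.
Implicit Types (x y z p q r : S) (P Q R X Y Z : dclasses S).

Let mA {T : invSemigroupType} := @monoid.mulgA T.

Definition Uset x : set (dclasses S) := [set X | X ≺ emb x].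

Definition Usub x (xs : seq S) : set (dclasses S) :=
  Uset x `&` \bigcap_(y in [set` xs]) ~` Uset y.

Definition Gu := dclasses S.
HB.instance Definition _ := Choice.on Gu.

Definition Gu_basis : set (set Gu) :=
  [set U | exists x xs, (forall y, y \in xs -> y ≺ x) /\ U = Usub x xs].

Lemma Usub_inter x xs z X : (forall y, y \in xs -> y ≺ x) ->
  z ≺ x -> X ≺ emb z ->
  Usub x xs X <-> Usub z [seq y * (z^-1 * z) | y <- xs] X.
Proof.
move=> xsx zx Xz; have Xx : X ≺ emb x.
  by apply: sprec_trans Xz _; apply/emb_prec.
have key y : y \in xs -> (X ≺ emb y <-> X ≺ emb (y * (z^-1 * z))).
  move=> /xsx yx; split=> [Xy|h].
    have : X * (X^-1 * X) ≺ emb y * (emb z^-1 * emb z).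
      by apply: sprecM => //; rewrite -embV; exact: sprec_Vmul.
    by rewrite mA mulKVs !embM.
  apply: sprec_trans h _; apply/emb_prec.
  by apply: sprec_mulr; exact: idem_Vmul.
split=> -[_ h]; split=> //.
  by move=> _ /mapP[y yxs ->] /(key _ yxs); exact: h.
by move=> y yxs /(key _ yxs); apply: h; apply/mapP; exists y.
Qed.

Lemma Gu_basis_cover : \bigcup_(U in Gu_basis) U = setT.
Proof.
apply/seteqP; split=> // X _; have [x Xx] := ex_prec_emb X.
exists (Usub x [::]); first by exists x, [::].
by split=> // y.
Qed.

Lemma Usub_cat x xs ys : Usub x (xs ++ ys) = Usub x xs `&` Usub x ys.
Proof.
apply/seteqP; split=> X.
  by move=> [Xx h]; split; split=> // y /= yi; apply: h => /=;
    rewrite mem_cat yi ?orbT.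
move=> [[Xx h1] [_ h2]]; split=> // y /=.
by rewrite mem_cat => /orP[]; [exact: h1|exact: h2].
Qed.

Lemma Gu_basis_join (A B : set Gu) (X : Gu) : Gu_basis A -> Gu_basis B ->
  A X -> B X -> exists C, [/\ Gu_basis C, C X & C `<=` A `&` B].
Proof.
move=> [x [xs [hx ->]]] [y [ys [hy ->]]] AX BX.
have [z [Xz zx zy]] := prec_emb_dir AX.1 BX.1.
pose f u := u * (z^-1 * z).
exists (Usub z ([seq f u | u <- xs] ++ [seq f u | u <- ys])).
have sub u t : t ≺ u -> z ≺ u -> f t ≺ z.
  move=> tu /sprecP h; have : t * (z^-1 * z) ≺ u * (z^-1 * z) by exact: sprecM.
  by rewrite -h.
split.
- exists z, ([seq f u | u <- xs] ++ [seq f u | u <- ys]); split=> // u.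
  rewrite mem_cat => /orP[] /mapP[t tin ->].
    exact: sub (hx _ tin) zx.
  exact: sub (hy _ tin) zy.
- by rewrite Usub_cat; split; [apply/(Usub_inter hx)|apply/(Usub_inter hy)].
rewrite Usub_cat => W [W1 W2]; have Wz := W1.1.
by split; [apply/(Usub_inter hx zx Wz)|apply/(Usub_inter hy zy Wz)].
Qed.

HB.instance Definition _ := isBaseTopological.Build Gu
  Gu_basis_cover Gu_basis_join.

Lemma Gu_basisP : basis Gu_basis.
Proof.
split=> [U BU|X A].
  by exists [set U]; [move=> _ ->|rewrite bigcup_set1].
rewrite nbhsE /= => -[O [[D DB <-] [U DU UX]] OA].
exists U; first by split=> //; exact: DB.
by move=> W UW; apply: OA; exists U.
Qed.

Definition Gu_composable (X Y : Gu) : Prop := X^-1 * X = Y * Y^-1.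

Lemma Gu_mulA (X Y Z : Gu) : Gu_composable X Y -> Gu_composable Y Z ->
  [/\ Gu_composable (X * Y) Z, Gu_composable X (Y * Z) & X * Y * Z = X * (Y * Z)].
Proof.
rewrite /Gu_composable => XY YZ; split; last by rewrite mA.
  by rewrite -YZ invsM mA -(mA Y^-1 X^-1 X) XY mA mulVKs.
by rewrite XY invsM mA -(mA Y Z Z^-1) -YZ mA mulKVs.
Qed.

Lemma Gu_composableV (X : Gu) : Gu_composable X^-1 X.
Proof. by rewrite /Gu_composable invsK. Qed.

Lemma Gu_mulKV (X Y : Gu) : Gu_composable X Y -> X^-1 * (X * Y) = Y.
Proof. by rewrite /Gu_composable mA => ->; rewrite mulKVs. Qed.

Lemma Gu_mulVK (X Y : Gu) : Gu_composable X Y -> X * Y * Y^-1 = X.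
Proof. by rewrite /Gu_composable -mA => <-; rewrite mA mulKVs. Qed.

HB.instance Definition _ := isGroupoid.Build Gu
  (@invsK _) Gu_mulA Gu_composableV Gu_mulKV Gu_mulVK.

Lemma Gu_nbhsP (X : Gu) (A : set Gu) : nbhs X A <->
  exists x xs, [/\ (forall y, y \in xs -> y ≺ x), Usub x xs X & Usub x xs `<=` A].
Proof.
split=> [/(Gu_basisP.2 X)[_ [[x [xs [h ->]]] UX UA]]|[x [xs [h UX UA]]]].
  by exists x, xs.
apply: filterS UA _; apply: open_nbhs_nbhs; split=> //.
by apply: Gu_basisP.1; exists x, xs.
Qed.

Lemma precVE (T : invSemigroupType) (a b : T) : a^-1 ≺ b <-> a ≺ b^-1.
Proof. by split=> /sprecV; rewrite invsK. Qed.

Lemma Gu_inv_continuous : continuous (@ginv Gu).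
Proof.
move=> X A /Gu_nbhsP[x [xs [h [Xx Xxs] UA]]]; apply/Gu_nbhsP.
exists x^-1, [seq y^-1 | y <- xs]; split.
- by move=> _ /mapP[y yxs ->]; apply: sprecV; exact: h.
- split; first by rewrite /Uset /= -embV; apply/precVE.
  move=> _ /mapP[y yxs ->] /=; rewrite /Uset /= -embV => /precVE.
  exact: Xxs.
move=> Y [Yx Yxs]; apply: UA; split.
  by move: Yx; rewrite /Uset /= -embV => /precVE.
move=> y yxs /precVE; rewrite embV; apply: Yxs.
by apply/mapP; exists y.
Qed.

Lemma Gu_mul_continuous :
  {within [set u : Gu * Gu | composable u.1 u.2],
    continuous (fun u => gmul u.1 u.2)}.
Proof.
apply/subspace_continuousP => -[X Y] /= XYc A.
move=> /Gu_nbhsP[z [zs [hz [/= Zz Zzs] UA]]].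
have [x [y [Xx Yy xyz]]] := prec_embM Zz.
have hz' t : t \in zs -> t * ((x * y)^-1 * (x * y)) ≺ x * y.
  move=> /hz tz; have /sprecP h := xyz; rewrite {3}h.
  by apply: sprecM.
pose f t := t * ((x * y)^-1 * (x * y)) * y^-1.
have eqv (X' Y' : Gu) : composable X' Y' -> Uset x X' -> Uset y Y' ->
    forall t, t \in zs -> (X' * Y' ≺ emb t <-> X' ≺ emb (f t)).
  move=> c Xx' Yy' t tzs; have Xy' : X' * Y' ≺ emb (x * y).
    by rewrite -embM; exact: sprecM.
  split=> [XYt|Xf].
    rewrite -(Gu_mulVK c) /f -embM; apply: sprecM; last first.
      by rewrite -embV; exact: sprecV.
    have -> : X' * Y' = X' * Y' * ((X' * Y')^-1 * (X' * Y')).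
      by rewrite mA mulKVs.
    have -> : emb (t * ((x * y)^-1 * (x * y))) =
        emb t * ((emb (x * y))^-1 * emb (x * y)) by rewrite embV !embM.
    by apply: sprecM; [exact: XYt|exact: sprec_Vmul].
  have : X' * Y' ≺ emb (f t * y) by rewrite -embM; exact: sprecM.
  move=> /sprec_trans; apply; apply/emb_prec.
  rewrite /f -(mA _ y^-1 y) -(mA t); apply: sprec_mulr.
  by apply: idemM; exact: idem_Vmul.
rewrite /within /=; near_simpl.
exists (Usub x [seq f t | t <- zs], Usub y [::]); first (split; apply/Gu_nbhsP).
- exists x, [seq f t | t <- zs]; split=> //.
    move=> _ /mapP[t /hz' h ->].
    apply: (@sprec_trans _ (x * y * y^-1)); first exact: sprecM.
    by rewrite -mA; apply: sprec_mulr; exact: idem_mulV.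
  split=> // _ /mapP[t tzs ->] /(eqv _ _ XYc Xx Yy t tzs).
  exact: Zzs.
- by exists y, [::]; split=> //; split.
move=> [X' Y'] [[/= Xx' Xxs'] [Yy' _]] c; apply: UA; split.
  apply: (@sprec_trans _ (emb (x * y))); last exact/emb_prec.
  by rewrite -embM; exact: sprecM.
move=> t tzs /(eqv _ _ c Xx' Yy' t tzs); apply: Xxs'.
by apply/mapP; exists t.
Qed.

HB.instance Definition _ := Groupoid_isTopological.Build Gu
  Gu_inv_continuous Gu_mul_continuous.

Lemma conjK (T : invSemigroupType) (P u : T) : idem P -> P ≺ u * u^-1 ->
  u * (u^-1 * P * u) * u^-1 = P.
Proof.
move=> PP Pu; have iu := idem_mulV u.
have h := (sprec_idemP PP iu).1 Pu.
transitivity ((u * u^-1) * P * (u * u^-1)); first by rewrite !mA.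
by rewrite -(mA _ P) h (idemC iu PP) h.
Qed.

Definition germ_pair P x : Prop := idem P /\ P ≺ emb (x * x^-1).

(* Pairs (P, x) before identification; germ below is the class [P, x]. *)
Record pair_type := GermPair {
  pair_unit : dclasses S;
  pair_elt : S;
  pairP : germ_pair pair_unit pair_elt
}.

HB.instance Definition _ := gen_eqMixin pair_type.
HB.instance Definition _ := gen_choiceMixin pair_type.

Definition pair_eq (a b : pair_type) : Prop :=
  pair_unit a = pair_unit b /\
  exists p, pair_unit a ≺ emb p /\ p * pair_elt a = p * pair_elt b.

Definition pair_eqb (a b : pair_type) : bool := `[< pair_eq a b >].

Lemma germ_idem P x y : idem P -> (exists p, P ≺ emb p /\ p * x = p * y) ->
  exists p, [/\ idem p, P ≺ emb p & p * x = p * y].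
Proof.
move=> PP [p [Pp e]]; have [q [qq Pq qp]] := prec_emb_idem PP Pp.
exists q; split=> //; move: qp => /sprec_l.
rewrite (idem_inv qq) qq => ->.
by rewrite -!mA e.
Qed.

Lemma pair_eqb_refl : reflexive pair_eqb.
Proof.
move=> [P x [PP Px]]; apply/asboolP; split=> //=.
by exists (x * x^-1); split.
Qed.

Lemma pair_eqb_sym : symmetric pair_eqb.
Proof.
suff h a b : pair_eqb a b -> pair_eqb b a by move=> a b; apply/idP/idP; exact: h.
move=> /asboolP[e [p [Pp pe]]]; apply/asboolP; split=> //.
by exists p; rewrite -e.
Qed.

Lemma germ_trans P x y z : idem P -> (exists p, P ≺ emb p /\ p * x = p * y) ->
  (exists p, P ≺ emb p /\ p * y = p * z) -> exists p, P ≺ emb p /\ p * x = p * z.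
Proof.
move=> PP /(germ_idem PP)[p [pp Pp pe]] /(germ_idem PP)[q [qq Pq qe]].
exists (p * q); split; first by rewrite -embM; apply: sprec_meet => //; exact: emb_idem.
rewrite -(mA p q z) -qe mA (idemC pp qq) -!mA pe.
by [].
Qed.

Lemma pair_eqb_trans : transitive pair_eqb.
Proof.
move=> [Q y [QQ Qy]] [P x [PP Px]] [R z [RR Rz]].
move=> /asboolP[/= e1 h1] /asboolP[/= e2 h2]; apply/asboolP; split => /=.
  by rewrite e1.
by apply: germ_trans h1 _ => //; rewrite e1.
Qed.

Canonical pair_equiv := EquivRel pair_eqb pair_eqb_refl pair_eqb_sym pair_eqb_trans.

Definition Hu := {eq_quot pair_equiv}.
HB.instance Definition _ := Choice.on Hu.
HB.instance Definition _ := EqQuotient.on Hu.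

Definition germ P x (Px : germ_pair P x) : Hu := \pi_Hu (GermPair Px).

Lemma germ_eq P x (Px : germ_pair P x) Q y (Qy : germ_pair Q y) :
  germ Px = germ Qy <-> P = Q /\ exists p, P ≺ emb p /\ p * x = p * y.
Proof. by split=> [/eqmodP/asboolP//|h]; apply/eqmodP/asboolP. Qed.

Lemma germP (a : Hu) : exists P x (Px : germ_pair P x), a = germ Px.
Proof.
rewrite -[a]reprK; case: (repr a) => P x Px.
by exists P, x, Px.
Qed.

Definition Hu_basic x p (ps : seq S) : set Hu :=
  [set a | exists P (Px : germ_pair P x), Usub p ps P /\ a = germ Px].

Definition Hu_basis : set (set Hu) :=
  [set B | exists x p ps,
    [/\ idem p, p ≺ x * x^-1,
        forall q, q \in ps -> idem q /\ q ≺ p & B = Hu_basic x p ps]].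

Lemma Hu_basicP x p ps P y (Py : germ_pair P y) : p ≺ x * x^-1 ->
  Hu_basic x p ps (germ Py) <->
  Usub p ps P /\ exists q, P ≺ emb q /\ q * y = q * x.
Proof.
move=> px; split=> [[Q [Qx [UQ /germ_eq[-> h]]]] //|[UP h]].
have Px : germ_pair P x.
  by split; [exact: Py.1|apply: sprec_trans UP.1 _; exact/emb_prec].
by exists P, Px; split=> //; apply/germ_eq.
Qed.

Lemma Hu_basis_cover : \bigcup_(U in Hu_basis) U = setT.
Proof.
apply/seteqP; split=> // a _; have [P [x [Px ->]]] := germP a.
exists (Hu_basic x (x * x^-1) [::]).
  by exists x, (x * x^-1), [::]; split=> //; exact: idem_mulV.
by exists P, Px; split=> //; split=> //; exact: Px.2.
Qed.

Lemma Usub_idem p ps r P : idem p -> (forall q, q \in ps -> idem q /\ q ≺ p) ->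
  idem r -> r ≺ p -> P ≺ emb r ->
  Usub p ps P <-> Usub r [seq q * r | q <- ps] P.
Proof.
move=> pp hps rr rp Pr.
have -> : [seq q * r | q <- ps] = [seq q * (r^-1 * r) | q <- ps].
  by rewrite idem_inv // rr.
by apply: (@Usub_inter p) => // q /hps[].
Qed.

Lemma restrP p ps r : idem r -> (forall q, q \in ps -> idem q /\ q ≺ p) ->
  forall q, q \in [seq q * r | q <- ps] -> idem q /\ q ≺ r.
Proof.
move=> rr hps _ /mapP[q /hps[qq _] ->]; split; first exact: idemM.
exact: sprec_mull.
Qed.

Lemma Hu_basis_join (A B : set Hu) (a : Hu) : Hu_basis A -> Hu_basis B ->
  A a -> B a -> exists C, [/\ Hu_basis C, C a & C `<=` A `&` B].
Proof.
move=> [x [p [ps [pp px hps ->]]]] [y [q [qs [qq qy hqs ->]]]].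
have [P [z [Pz ->]]] := germP a; have PP := Pz.1.
move=> /(Hu_basicP _ _ px)[UP hx] /(Hu_basicP _ _ qy)[UQ hy].
have hxy : exists s, P ≺ emb s /\ s * x = s * y.
  apply: germ_trans hy => //; case: hx => s [Ps sx].
  by exists s.
have [s [ss Ps sxy]] := germ_idem PP hxy.
pose r := p * (q * s).
have rr : idem r by do 2?apply: idemM => //.
have Pr : P ≺ emb r.
  have Pqs : P ≺ emb (q * s).
    rewrite -embM; apply: sprec_meet => //; [exact: emb_idem|exact: UQ.1].
  by rewrite -embM; apply: sprec_meet => //; [exact: emb_idem|exact: UP.1].
have rp : r ≺ p by apply: sprec_mulr; exact: idemM.
have rqs : r ≺ q * s by exact: sprec_mull.
have rq : r ≺ q by apply: sprec_trans rqs _; exact: sprec_mulr.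
have rs : r ≺ s by apply: sprec_trans rqs _; exact: sprec_mull.
have rx : r ≺ x * x^-1 := sprec_trans rp px.
have rxy : r * x = r * y.
  rewrite -((sprec_idemP rr ss).1 rs).
  by rewrite -!mA sxy.
pose rps := [seq u * r | u <- ps]; pose rqs' := [seq u * r | u <- qs].
exists (Hu_basic x r (rps ++ rqs')); split.
- exists x, r, (rps ++ rqs'); split=> // u; rewrite mem_cat => /orP[].
    exact: (restrP rr hps).
  exact: (restrP rr hqs).
- apply/Hu_basicP => //; split=> //; rewrite Usub_cat; split.
    exact/(Usub_idem pp hps).
  exact/(Usub_idem qq hqs).
move=> b; have [W [w [Ww ->]]] := germP b.
move=> /(Hu_basicP _ _ rx)[]; rewrite Usub_cat => -[W1 W2] h.
have Wr := W1.1; split.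
  apply/(Hu_basicP _ _ px); split=> //; exact/(Usub_idem pp hps rr rp Wr).
apply/(Hu_basicP _ _ qy); split; first exact/(Usub_idem qq hqs rr rq Wr).
by apply: germ_trans h _; [exact: Ww.1|exists r].
Qed.

HB.instance Definition _ := isBaseTopological.Build Hu
  Hu_basis_cover Hu_basis_join.

Lemma Hu_basisP : basis Hu_basis.
Proof.
split=> [U BU|a A].
  by exists [set U]; [move=> _ ->|rewrite bigcup_set1].
rewrite nbhsE /= => -[O [[D DB <-] [U DU UX]] OA].
exists U; first by split=> //; exact: DB.
by move=> W UW; apply: OA; exists U.
Qed.

Definition conj_by P x : dclasses S := emb x^-1 * P * emb x.

Lemma conj_idem P x : idem P -> idem (conj_by P x).
Proof. by move=> PP; rewrite /conj_by -embV; exact: idem_conjV. Qed.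

Lemma conj_mono P Q x : P ≺ Q -> conj_by P x ≺ conj_by Q x.
Proof. by move=> PQ; apply: sprecM => //; apply: sprecM. Qed.

Lemma conj_emb p x : conj_by (emb p) x = emb (x^-1 * p * x).
Proof. by rewrite /conj_by !embM. Qed.

Lemma conjM P x y : conj_by P (x * y) = conj_by (conj_by P x) y.
Proof. by rewrite /conj_by invsM -!embM !mA. Qed.

Lemma conjVK P x : germ_pair P x -> conj_by (conj_by P x) x^-1 = P.
Proof.
move=> [PP Px]; rewrite /conj_by invsK -[RHS](@conjK _ _ (emb x)) ?embV //.
by rewrite embM.
Qed.

Lemma germ_pairV P x : germ_pair P x -> germ_pair (conj_by P x) x^-1.
Proof.
move=> [PP Px]; split; first exact: conj_idem.
rewrite invsK; apply: sprec_trans (conj_mono x Px) _.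
by rewrite conj_emb mA mulVKs.
Qed.

Lemma germ_pairM P x y : germ_pair P x -> germ_pair (conj_by P x) y ->
  germ_pair P (x * y).
Proof.
move=> Px [_ Qy]; split; first exact: Px.1.
rewrite -(conjVK Px); apply: sprec_trans (conj_mono _ Qy) _.
by rewrite conj_emb invsK invsM !mA.
Qed.

Lemma germ_conj P x y : idem P -> (exists p, P ≺ emb p /\ p * x = p * y) ->
  conj_by P x = conj_by P y.
Proof.
move=> PP /(germ_idem PP)[p [pp Pp pe]].
have h z : conj_by P z = emb (p * z)^-1 * P * emb (p * z).
  have e1 := (sprec_idemP PP (emb_idem pp)).1 Pp.
  rewrite invsM (idem_inv pp) -!embM /conj_by !mA -(mA _ (emb p) P).
  rewrite -(idemC PP (emb_idem pp)) e1 -(mA _ P (emb p)) e1.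
  by [].
by rewrite !h pe.
Qed.

Lemma germ_mul_eq P x x' y y' : idem P -> P ≺ emb (x * x^-1) ->
  (exists p, P ≺ emb p /\ p * x = p * x') ->
  (exists p, conj_by P x ≺ emb p /\ p * y = p * y') ->
  exists p, P ≺ emb p /\ p * (x * y) = p * (x' * y').
Proof.
move=> PP Px /(germ_idem PP)[p [pp Pp pe]].
move=> /(germ_idem (conj_idem x PP))[q [qq Qq qe]].
have Pq : P ≺ emb (x * q * x^-1).
  rewrite -(conjVK (conj PP Px)); apply: sprec_trans (conj_mono _ Qq) _.
  by rewrite conj_emb invsK.
have cc : idem (x * q * x^-1) by exact: idem_conj.
exists (p * (x * q * x^-1)); split.
  by rewrite -embM; apply: sprec_meet => //; exact: emb_idem.
have E y0 : p * (x * q * x^-1) * (x * y0) = p * x * q * y0.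
  transitivity (p * ((x * q * x^-1) * x) * y0); first by rewrite !mA.
  by rewrite -mul_idem_r // !mA.
rewrite E -(mA (p * x)) qe mA -E (idemC pp cc) -!mA (mA p x) pe !mA.
by [].
Qed.

(* Independent of the representative by Hu_inv_germ. *)
Definition Hu_inv (a : Hu) : Hu := germ (germ_pairV (pairP (repr a))).

Lemma Hu_inv_germ P x (Px : germ_pair P x) :
  Hu_inv (germ Px) = germ (germ_pairV Px).
Proof.
rewrite /Hu_inv; move: (@reprK _ _ (germ Px)); case: (repr _) => Q y Qy /=.
move=> e; have {e} : germ Qy = germ Px by [].
move=> /germ_eq[QP h]; subst Q; have PP := Px.1.
have hc := germ_conj PP h; apply/germ_eq; split=> //.
move: h => /(germ_idem PP)[p [pp Pp pe]].
have se : y^-1 * p * y = x^-1 * p * x.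
  have E z : z^-1 * p * z = (p * z)^-1 * (p * z).
    by rewrite invsM (idem_inv pp) !mA -(mA _ p p) pp.
  by rewrite !E pe.
have F z : z^-1 * p * z * z^-1 = z^-1 * p.
  by rewrite -(mA _ z) -mA (idemC pp (idem_mulV z)) !mA mulVKs.
exists (y^-1 * p * y); split.
  by rewrite -conj_emb; exact: conj_mono.
rewrite /= F se F.
by have := congr1 (@invs _) pe; rewrite !invsM (idem_inv pp).
Qed.

Definition Hu_prod (a b c : Hu) : Prop :=
  exists P x y (Px : germ_pair P x) (Qy : germ_pair (conj_by P x) y),
    [/\ a = germ Px, b = germ Qy & c = germ (germ_pairM Px Qy)].

Lemma Hu_prodP P x (Px : germ_pair P x) Q y (Qy : germ_pair Q y) (c : Hu) :
  Hu_prod (germ Px) (germ Qy) c <->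
  Q = conj_by P x /\ exists h : germ_pair P (x * y), c = germ h.
Proof.
split=> [[P' [x' [y' [Px' [Qy' [/germ_eq[e hx] /germ_eq[e' hy] ->]]]]]]|].
  subst P'; have PP := Px.1; have hc := germ_conj PP hx.
  have eQ : Q = conj_by P x by rewrite e' hc.
  split=> //; have Qy2 : germ_pair (conj_by P x) y by rewrite -eQ.
  exists (germ_pairM Px Qy2); apply/germ_eq; split=> //.
  have hy2 : exists p, conj_by P x ≺ emb p /\ p * y = p * y' by rewrite -eQ.
  have [p [Pp pe]] := germ_mul_eq PP Px.2 hx hy2.
  by exists p; rewrite pe.
move=> [e [h ->]]; subst Q; exists P, x, y, Px, Qy; split=> //.
by apply/germ_eq; split=> //; exists (x * x^-1); split=> //; exact: Px.2.
Qed.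

Definition Hu_composable (a b : Hu) : Prop := exists c, Hu_prod a b c.

(* The default value of xget is only reached off the composable pairs; on
   them the product is determined by Hu_mul_germ. *)
Definition Hu_mul (a b : Hu) : Hu := xget a [set c | Hu_prod a b c].

Lemma Hu_composable_germ P x (Px : germ_pair P x) Q y (Qy : germ_pair Q y) :
  Hu_composable (germ Px) (germ Qy) <-> Q = conj_by P x.
Proof.
split=> [[c /Hu_prodP[]]//|e]; subst Q.
exists (germ (germ_pairM Px Qy)); apply/Hu_prodP; split=> //.
by exists (germ_pairM Px Qy).
Qed.

Lemma Hu_mul_germ P x (Px : germ_pair P x) y (Qy : germ_pair (conj_by P x) y)
  (h : germ_pair P (x * y)) : Hu_mul (germ Px) (germ Qy) = germ h.
Proof.
rewrite /Hu_mul; case: xgetP => [c _ /Hu_prodP[_ [k ->]]|].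
  by apply/germ_eq; split=> //; exists (x * x^-1); split=> //; exact: Px.2.
by move=> /(_ (germ h)); case; apply/Hu_prodP; split=> //; exists h.
Qed.

Lemma Hu_invK (a : Hu) : Hu_inv (Hu_inv a) = a.
Proof.
have [P [x [Px ->]]] := germP a; rewrite !Hu_inv_germ; apply/germ_eq.
rewrite conjVK //; split=> //; exists (x * x^-1); rewrite invsK.
by split=> //; exact: Px.2.
Qed.

Lemma Hu_mulA (a b c : Hu) : Hu_composable a b -> Hu_composable b c ->
  [/\ Hu_composable (Hu_mul a b) c, Hu_composable a (Hu_mul b c) &
      Hu_mul (Hu_mul a b) c = Hu_mul a (Hu_mul b c)].
Proof.
have [P [x [Px ->]]] := germP a; have [Q [y [Qy ->]]] := germP b.
have [R [z [Rz ->]]] := germP c.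
move=> /Hu_composable_germ e1 /Hu_composable_germ e2; subst R; subst Q.
have Pxy := germ_pairM Px Qy; have Qyz := germ_pairM Qy Rz.
rewrite (Hu_mul_germ _ _ Pxy) (Hu_mul_germ _ _ Qyz).
have Rz' : germ_pair (conj_by P (x * y)) z by rewrite conjM.
have -> : germ Rz = germ Rz'.
  apply/germ_eq; rewrite conjM; split=> //.
  by exists (z * z^-1); split=> //; exact: Rz.2.
have Pxyz := germ_pairM Pxy Rz'; have Pxyz' := germ_pairM Px Qyz.
rewrite (Hu_mul_germ _ _ Pxyz) (Hu_mul_germ _ _ Pxyz'); split.
- exact/Hu_composable_germ.
- exact/Hu_composable_germ.
apply/germ_eq; split=> //; exists (x * x^-1).
by split; [exact: Px.2|rewrite !mA].
Qed.

Lemma Hu_composableV (a : Hu) : Hu_composable (Hu_inv a) a.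
Proof.
have [P [x [Px ->]]] := germP a; rewrite Hu_inv_germ.
by apply/Hu_composable_germ; rewrite conjVK.
Qed.

Lemma germ_proof_irr P Q x (Px : germ_pair P x) (Qx : germ_pair Q x) :
  P = Q -> germ Px = germ Qx.
Proof.
move=> e; apply/germ_eq; split=> //; exists (x * x^-1); split=> //.
exact: Px.2.
Qed.

Lemma Hu_mulKV (a b : Hu) : Hu_composable a b -> Hu_mul (Hu_inv a) (Hu_mul a b) = b.
Proof.
have [P [x [Px ->]]] := germP a; have [Q [y [Qy ->]]] := germP b.
move=> /Hu_composable_germ e; subst Q.
have Pxy := germ_pairM Px Qy; rewrite (Hu_mul_germ _ _ Pxy) Hu_inv_germ.
have h : germ_pair (conj_by (conj_by P x) x^-1) (x * y) by rewrite conjVK.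
rewrite (germ_proof_irr Pxy h) ?conjVK //.
have k := germ_pairM (germ_pairV Px) h; rewrite (Hu_mul_germ _ _ k).
apply/germ_eq; split=> //; exists (x^-1 * x); split.
  by have := (germ_pairV Px).2; rewrite invsK.
by rewrite !mA mulVKs.
Qed.

Lemma Hu_mulVK (a b : Hu) : Hu_composable a b -> Hu_mul (Hu_mul a b) (Hu_inv b) = a.
Proof.
have [P [x [Px ->]]] := germP a; have [Q [y [Qy ->]]] := germP b.
move=> /Hu_composable_germ e; subst Q.
have Pxy := germ_pairM Px Qy; rewrite (Hu_mul_germ _ _ Pxy) Hu_inv_germ.
have h : germ_pair (conj_by P (x * y)) y^-1 by rewrite conjM; exact: germ_pairV.
rewrite (germ_proof_irr (germ_pairV Qy) h) ?conjM //.
have k := germ_pairM Pxy h; rewrite (Hu_mul_germ _ _ k).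
apply/germ_eq; split=> //; exists (x * y * (x * y)^-1); split; first exact: Pxy.2.
rewrite (mA _ (x * y)) mulKVs invsM (mA (x * y) y^-1) -(mA x y).
by rewrite -mul_idem_r //; exact: idem_mulV.
Qed.

HB.instance Definition _ := isGroupoid.Build Hu
  Hu_invK Hu_mulA Hu_composableV Hu_mulKV Hu_mulVK.

Lemma Hu_nbhsP (a : Hu) (A : set Hu) : nbhs a A <->
  exists x p ps, [/\ idem p, p ≺ x * x^-1,
    forall q, q \in ps -> idem q /\ q ≺ p &
    Hu_basic x p ps a /\ Hu_basic x p ps `<=` A].
Proof.
split=> [/(Hu_basisP.2 a)[_ [[x [p [ps [pp px h ->]]]] Ua UA]]|].
  by exists x, p, ps.
move=> [x [p [ps [pp px h [Ua UA]]]]].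
apply: filterS UA _; apply: open_nbhs_nbhs; split=> //.
by apply: Hu_basisP.1; exists x, p, ps.
Qed.

Lemma shrink P x p ps q : idem P -> idem p ->
  (forall t, t \in ps -> idem t /\ t ≺ p) -> idem q ->
  Usub p ps P -> P ≺ emb q ->
  exists r rs, [/\ idem r, r ≺ q /\ r ≺ p,
    forall t, t \in rs -> idem t /\ t ≺ r, Usub r rs P &
    Usub r rs `<=` Usub p ps].
Proof.
move=> PP pp hps qq UP Pq; have rr := idemM pp qq.
have Pr : P ≺ emb (p * q).
  by rewrite -embM; apply: sprec_meet => //; [exact: emb_idem|exact: UP.1].
have rp : p * q ≺ p by exact: sprec_mulr.
exists (p * q), [seq t * (p * q) | t <- ps]; split=> //.
- by split=> //; exact: sprec_mull.
- exact: (restrP rr hps).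
- exact/(Usub_idem pp hps).
by move=> W UW; apply/(Usub_idem pp hps rr rp UW.1).
Qed.

Lemma Usub_conj x r rs P : idem r -> (forall t, t \in rs -> idem t /\ t ≺ r) ->
  r ≺ x * x^-1 -> germ_pair P x ->
  Usub r rs P <-> Usub (x^-1 * r * x) [seq x^-1 * t * x | t <- rs] (conj_by P x).
Proof.
move=> rr hrs rx Px.
have key t : idem t -> t ≺ x * x^-1 ->
    (P ≺ emb t <-> conj_by P x ≺ emb (x^-1 * t * x)).
  move=> tt tx; split=> [Pt|h]; first by rewrite -conj_emb; exact: conj_mono.
  rewrite -(conjVK Px); apply: sprec_trans (conj_mono _ h) _.
  by rewrite conj_emb invsK conjK.
have key2 t : t \in rs -> (P ≺ emb t <-> conj_by P x ≺ emb (x^-1 * t * x)).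
  by move=> /hrs[tt tr]; apply: key => //; exact: sprec_trans tr rx.
split=> -[h1 h2]; split; try exact/(key r).
  by move=> _ /mapP[t trs ->] /(key2 t trs); exact: h2.
by move=> t trs /(key2 t trs); apply: h2; apply/mapP; exists t.
Qed.

Lemma conj_list x r rs : (forall t, t \in rs -> idem t /\ t ≺ r) ->
  forall t, t \in [seq x^-1 * t * x | t <- rs] -> idem t /\ t ≺ x^-1 * r * x.
Proof.
move=> h _ /mapP[t /h[tt tr] ->]; split; first exact: idem_conjV.
by apply: sprecM => //; apply: sprecM.
Qed.

Lemma Hu_inv_continuous : continuous (@ginv Hu).
Proof.
move=> a A /Hu_nbhsP[z [p [ps [pp pz hps [Ua UA]]]]]; apply/Hu_nbhsP.
have [P [x [Px ea]]] := germP a; subst a; have Qx := germ_pairV Px.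
move: Ua; rewrite /= /ginv /= Hu_inv_germ => /(Hu_basicP _ _ pz)[UQ h].
have [q [qq Qq qe]] := germ_idem Qx.1 h.
have [] := @shrink (conj_by P x) x p ps (q * (x^-1 * x)) Qx.1 pp hps _ UQ.
- by apply: idemM => //; exact: idem_Vmul.
- rewrite -embM; apply: sprec_meet => //; first exact: emb_idem.
  by have := Qx.2; rewrite invsK.
move=> r [rs [rr [rqx rp] hrs Ur Urs]].
have rq : r ≺ q by apply: sprec_trans rqx _; apply: sprec_mulr; exact: idem_Vmul.
have rx : r ≺ x^-1 * x^-1^-1 by rewrite invsK; apply: sprec_trans rqx _; exact: sprec_mull.
have rzx : r * x^-1 = r * z.
  rewrite -((sprec_idemP rr qq).1 rq).
  by rewrite -!mA qe.
have xrx : x * r * x^-1 ≺ x * x^-1.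
  by apply: sprecM => //; exact: sprec_mulr.
exists x, (x * r * x^-1), [seq x * t * x^-1 | t <- rs]; split=> //.
- exact: idem_conj.
- by have := @conj_list x^-1 r rs hrs; rewrite invsK.
have key P' (Px' : germ_pair P' x) :
    Usub (x * r * x^-1) [seq x * t * x^-1 | t <- rs] P' <-> Usub r rs (conj_by P' x).
  have := Usub_conj rr hrs rx (germ_pairV Px').
  by rewrite conjVK // invsK; apply: iff_sym.
split; first by exists P, Px; split=> //; exact/key.
move=> _ [P' [Px' [U' ->]]]; apply: UA; rewrite /= /ginv /= Hu_inv_germ.
have UR := (key _ Px').1 U'.
apply/Hu_basicP => //; split; first exact: Urs.
by exists r; split=> //; exact: UR.1.
Qed.

Lemma Hu_mul_continuous :
  {within [set u : Hu * Hu | composable u.1 u.2],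
    continuous (fun u => gmul u.1 u.2)}.
Proof.
apply/subspace_continuousP => -[a b] /= abc A.
move=> /Hu_nbhsP[z [p [ps [pp pz hps [Ua UA]]]]].
have [P [x [Px ea]]] := germP a; have [Q [y [Qy eb]]] := germP b.
subst a b; move: abc => /Hu_composable_germ e; subst Q.
have Pxy := germ_pairM Px Qy; have PP := Px.1.
move: Ua; rewrite /= /gmul /= /from_subspace (Hu_mul_germ _ _ Pxy).
move=> /(Hu_basicP _ _ pz)[UQ h].
have [q [qq Pq qe]] := germ_idem PP h.
have [] := @shrink P x p ps (q * (x * y * (x * y)^-1)) PP pp hps _ UQ.
- by apply: idemM => //; exact: idem_mulV.
- by rewrite -embM; apply: sprec_meet => //; [exact: emb_idem|exact: Pxy.2].
move=> r [rs [rr [rqx rp] hrs Ur Urs]].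
have rq : r ≺ q by apply: sprec_trans rqx _; apply: sprec_mulr; exact: idem_mulV.
have rxy : r ≺ x * y * (x * y)^-1 by apply: sprec_trans rqx _; exact: sprec_mull.
have rx : r ≺ x * x^-1.
  apply: sprec_trans rxy _; rewrite invsM mA -(mA x); apply: sprecM => //.
  by apply: sprec_mulr; exact: idem_mulV.
have rz : r * (x * y) = r * z.
  rewrite -((sprec_idemP rr qq).1 rq).
  by rewrite -!(mA r) qe.
have yr : x^-1 * r * x ≺ y * y^-1.
  have : x^-1 * r * x ≺ x^-1 * (x * y * (x * y)^-1) * x.
    by apply: sprecM => //; apply: sprecM.
  move=> /sprec_trans; apply.
  have -> : x^-1 * (x * y * (x * y)^-1) * x = (x^-1 * x) * (y * y^-1) * (x^-1 * x).
    by rewrite invsM !mA.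
  apply: (@sprec_trans _ (x^-1 * x * (y * y^-1))).
    by apply: sprec_mulr; exact: idem_Vmul.
  by apply: sprec_mull; exact: idem_Vmul.
exists (Hu_basic x r rs, Hu_basic y (x^-1 * r * x) [::]); first (split; apply/Hu_nbhsP).
- by exists x, r, rs; split=> //; split=> //; exists P, Px.
- exists y, (x^-1 * r * x), [::]; split=> //; first exact: idem_conjV.
  split=> //; exists (conj_by P x), Qy; split=> //; split=> //.
  by rewrite /Uset /= -conj_emb; apply: conj_mono; exact: Ur.1.
move=> [_ _] [/= [P' [Px' [UP' ->]]] [Q' [Qy' [UQ' ->]]]] /=.
move=> /Hu_composable_germ e; subst Q'; apply: UA.
have Pxy' := germ_pairM Px' Qy'; rewrite /gmul /= /from_subspace (Hu_mul_germ _ _ Pxy').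
apply/Hu_basicP => //; split; first exact: Urs.
by exists r; split=> //; exact: UP'.1.
Qed.

HB.instance Definition _ := Groupoid_isTopological.Build Hu
  Hu_inv_continuous Hu_mul_continuous.

Lemma germ_pair_above X x : X ≺ emb x -> germ_pair (X * X^-1) x.
Proof.
move=> Xx; split; first exact: idem_mulV.
by rewrite -embM -embV; exact: sprec_mulV.
Qed.

End UniversalGroupoids.

Definition topGroupoid_iso (G H : topGroupoidType) (f : G -> H) (g : H -> G) :
    Prop :=
  [/\ cancel f g /\ cancel g f,
      continuous f /\ continuous g,
      forall a b, composable a b <-> composable (f a) (f b),
      forall a b, composable a b -> f (gmul a b) = gmul (f a) (f b) &
      forall a, f (ginv a) = ginv (f a)].

(* Main.v *)
Require Import Defs.
From HB Require Import structures.
From mathcomp Require Import all_boot.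
From mathcomp Require Import all_classical.
From mathcomp Require Import topology.
Local Open Scope group_scope.

(* For X ≺ z the class X is recovered from its range XX^-1 as X = XX^-1 z, so X
   and the germ [XX^-1, z] determine each other. Moreover, for X ≺ z and q
   idempotent, X ≺ qz iff XX^-1 ≺ q; hence J and K exchange the basic sets
   U_{pz; q_1 z, ..., q_n z} of G_u with the basic sets of germs [P, z],
   P in U_{p; q_1, ..., q_n}, of H_u. *)

(* The mathcomp imports above rebind x^-1 to groups. *)
Local Notation "x ^-1" := (invs x) : group_scope.

Section Isomorphism.
Set Implicit Arguments.
Unset Strict Implicit.
Variable S : invSemigroupType.
Let mA {T : invSemigroupType} := @monoid.mulgA T.
Implicit Types (x y z p q : S) (P Q : dclasses S) (X Y : Gu S).

(** Makes J independent of x: as X is directed, some z above X lies below both x and y, and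
    [z * z^-1] carries both to z. *)
Lemma germ_above_eq X x y (Xx : X ≺ emb x) (Xy : X ≺ emb y) :
  germ (germ_pair_above Xx) = germ (germ_pair_above Xy).
Proof.
have [z [Xz zx zy]] := prec_emb_dir Xx Xy.
apply/germ_eq; split=> //; exists (z * z^-1); split.
  by rewrite -embM -embV; exact: sprec_mulV.
by rewrite -((sprec_l z x).1 zx) -((sprec_l z y).1 zy).
Qed.

(** Makes K well defined: the p identifying the pairs can be taken idempotent, so P = Pp and Px =
    Ppx = Ppy = Py. *)
Lemma germ_mul_emb P x (Px : germ_pair P x) Q y (Qy : germ_pair Q y) :
  germ Px = germ Qy -> P * emb x = Q * emb y.
Proof.
move=> /germ_eq[<- /(germ_idem Px.1)[p [pp Pp pe]]].
rewrite -((sprec_idemP Px.1 (emb_idem pp)).1 Pp).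
by rewrite -!mA !embM pe.
Qed.

Lemma germ_pair_mulV P x : germ_pair P x ->
  (P * emb x) * (P * emb x)^-1 = P.
Proof.
move=> [PP Px]; have ii := emb_idem (idem_mulV x).
rewrite invsM (idem_inv PP) mA -(mA P) embV embM.
by rewrite ((sprec_idemP PP ii).1 Px).
Qed.

Lemma germ_pair_prec P x : germ_pair P x -> P * emb x ≺ emb x.
Proof. by move=> [PP _]; exact: sprec_mull. Qed.

(** Forward, the range of qz is [q * (z * z^-1) * q], below q; backward, X = XX^-1 z ≺ qz. *)
Lemma prec_emb_mull X z q : idem q -> X ≺ emb z ->
  X ≺ emb (q * z) <-> X * X^-1 ≺ emb q.
Proof.
move=> qq Xz; split=> [/sprec_mulV Xq|Xq].
  apply: sprec_trans Xq _; rewrite embV embM; apply/emb_prec.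
  rewrite invsM (idem_inv qq) mA -(mA q z).
  apply: (@sprec_trans _ (q * (z * z^-1))).
    exact: sprec_mulr.
  by apply: sprec_mulr; exact: idem_mulV.
by rewrite ((sprec_l X (emb z)).1 Xz) -embM; apply: sprecM.
Qed.

Lemma Usub_range X z p (ps : seq S) :
  idem p -> (forall q, q \in ps -> idem q) -> X ≺ emb z ->
  Usub (p * z) [seq q * z | q <- ps] X <-> Usub p ps (X * X^-1).
Proof.
move=> pp hps Xz; split=> -[h1 h2]; split; try exact/(prec_emb_mull pp Xz).
  move=> q qps /(prec_emb_mull (hps q qps) Xz); apply: h2.
  by apply/mapP; exists q.
move=> _ /mapP[q qps ->] /(prec_emb_mull (hps q qps) Xz).
exact: h2.
Qed.

(** Expand X^-1 X with X = XX^-1 x. This matches the source of the germ of X with the source of X,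
    as composability and inversion require. *)
Lemma conj_range X x : X ≺ emb x -> conj_by (X * X^-1) x = X^-1 * X.
Proof.
move=> /sprec_l Xx; have ii := idem_mulV X.
transitivity ((X * X^-1 * emb x)^-1 * (X * X^-1 * emb x)); last by rewrite -Xx.
rewrite invsM (idem_inv ii) /conj_by embV.
by rewrite [RHS]mA -(mA _ (X * X^-1) (X * X^-1)) ii.
Qed.

(** The element above X is picked by choice; [Jmap_above] allows any other. *)
Definition Jmap X : Hu S :=
  germ (germ_pair_above (projT2 (cid (ex_prec_emb X)))).

Definition Kmap (a : Hu S) : Gu S :=
  pair_unit (repr a) * emb (pair_elt (repr a)).

Lemma Jmap_above X x (Xx : X ≺ emb x) : Jmap X = germ (germ_pair_above Xx).
Proof. exact: germ_above_eq. Qed.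

Lemma Kmap_germ P x (Px : germ_pair P x) : Kmap (germ Px) = P * emb x.
Proof.
rewrite /Kmap; move: (@reprK _ _ (germ Px)); case: (repr _) => Q y Qy /= e.
exact: germ_mul_emb e.
Qed.

Lemma JmapK : cancel Jmap Kmap.
Proof.
move=> X; have [x Xx] := ex_prec_emb X; rewrite (Jmap_above Xx) Kmap_germ.
by rewrite -((sprec_l X (emb x)).1 Xx).
Qed.

Lemma KmapK : cancel Kmap Jmap.
Proof.
move=> a; have [P [x [Px ->]]] := germP a; rewrite Kmap_germ.
rewrite (Jmap_above (germ_pair_prec Px)); apply: germ_proof_irr.
exact: germ_pair_mulV.
Qed.

Lemma Jmap_continuous : continuous Jmap.
Proof.
move=> X A /Hu_nbhsP[z [p [ps [pp pz hps [[P [Pz [UP e]]] UA]]]]].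
(* Applying K to J(X) = [P, z] puts X below the z of the given basic set. *)
have eX : X = P * emb z by rewrite -(JmapK X) e Kmap_germ.
have hps1 q : q \in ps -> idem q by move=> /hps[].
apply/Gu_nbhsP; exists (p * z), [seq q * z | q <- ps]; split.
- by move=> _ /mapP[q /hps[_ qp] ->]; exact: sprecM.
- have Xz : X ≺ emb z by rewrite eX; exact: germ_pair_prec.
  by apply/Usub_range => //; rewrite eX germ_pair_mulV.
move=> Y UY; have Yz : Y ≺ emb z.
  by apply: sprec_trans UY.1 _; apply/emb_prec; exact: sprec_mull.
apply: UA; exists (Y * Y^-1), (germ_pair_above Yz); split.
  exact/(Usub_range pp hps1 Yz).
exact: Jmap_above.
Qed.

Lemma Kmap_continuous : continuous Kmap.
Proof.
move=> a A /Gu_nbhsP[z [zs [hz Ua UA]]]; apply/Hu_nbhsP.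
(* Each t in [zs] lies below z, so t = tt^-1 z: the ranges tt^-1, with p = zz^-1, put an arbitrary
   basic set of G_u into the form required by [Usub_range]. *)
pose ps := [seq t * t^-1 | t <- zs].
have eU : Usub z zs = Usub (z * z^-1 * z) [seq q * z | q <- ps].
  rewrite mulKVs -map_comp; congr Usub; rewrite -[LHS]map_id.
  by apply/eq_in_map => t /hz /sprec_l.
have hps q : q \in ps -> idem q by move=> /mapP[t _ ->]; exact: idem_mulV.
have zz := idem_mulV z.
exists z, (z * z^-1), ps; split=> //.
  move=> _ /mapP[t /hz tz ->]; split; first exact: idem_mulV.
  exact: sprec_mulV.
have az : Kmap a ≺ emb z := Ua.1.
split.
  (* Since K(a) ≺ z, a = J(K(a)) is represented by a pair with second entry z. *)
  exists (Kmap a * (Kmap a)^-1), (germ_pair_above az); split.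
    by apply/(Usub_range zz hps az); rewrite -eU.
  by rewrite -Jmap_above KmapK.
move=> _ [P [Pz [UP ->]]]; apply: UA; rewrite /= Kmap_germ eU.
apply/Usub_range => //; first exact: germ_pair_prec.
by rewrite germ_pair_mulV.
Qed.

Lemma Jmap_composable X Y : composable X Y <-> composable (Jmap X) (Jmap Y).
Proof.
have [x Xx] := ex_prec_emb X; have [y Yy] := ex_prec_emb Y.
rewrite (Jmap_above Xx) (Jmap_above Yy).
apply: iff_trans (iff_sym (Hu_composable_germ _ _)).
by rewrite conj_range //; split=> h; apply: esym.
Qed.

Lemma Jmap_mul X Y : composable X Y -> Jmap (gmul X Y) = gmul (Jmap X) (Jmap Y).
Proof.
have [x Xx] := ex_prec_emb X; have [y Yy] := ex_prec_emb Y.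
move=> XY; have XYxy : X * Y ≺ emb (x * y) by rewrite -embM; exact: sprecM.
have eY : Y * Y^-1 = conj_by (X * X^-1) x by rewrite conj_range.
(* Composability turns X(YY^-1)X^-1 into X(X^-1 X)X^-1. *)
have eXY : (X * Y) * (X * Y)^-1 = X * X^-1.
  by rewrite invsM mA -(mA X Y) -(XY : _ = _) mA mulKVs.
have h : germ_pair (X * X^-1) (x * y).
  by rewrite -eXY; exact: germ_pair_above.
have Qy : germ_pair (conj_by (X * X^-1) x) y.
  by rewrite -eY; exact: germ_pair_above.
rewrite /gmul /= (Jmap_above XYxy) (Jmap_above Xx) (Jmap_above Yy).
(* The unit of J(Y) is rewritten as x^-1 (XX^-1) x, the form in which the product of germs is
   defined. *)
rewrite (germ_proof_irr (germ_pair_above Yy) Qy eY) (Hu_mul_germ _ _ h).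
exact: germ_proof_irr.
Qed.

Lemma Jmap_inv X : Jmap (ginv X) = ginv (Jmap X).
Proof.
have [x Xx] := ex_prec_emb X.
have Vx : X^-1 ≺ emb x^-1 by rewrite -embV; exact: sprecV.
rewrite /ginv /= (Jmap_above Vx) (Jmap_above Xx) Hu_inv_germ.
by apply: germ_proof_irr; rewrite conj_range // invsK.
Qed.

End Isomorphism.

Theorem theorem2 (S : invSemigroupType) :
  exists (J : Gu S -> Hu S) (K : Hu S -> Gu S),
    [/\ forall X : Gu S, exists x : S, X ≺ emb x,
        forall (X : Gu S) (x : S) (Xx : X ≺ emb x),
          J X = germ (germ_pair_above Xx),
        forall (P : dclasses S) (x : S) (Px : germ_pair P x),
          K (germ Px) = P * emb x &
        topGroupoid_iso J K].
Proof.
exists (@Jmap S), (@Kmap S); split.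
- exact: ex_prec_emb.
- exact: Jmap_above.
- exact: Kmap_germ.
split.
- by split; [exact: JmapK|exact: KmapK].
- by split; [exact: Jmap_continuous|exact: Kmap_continuous].
- exact: Jmap_composable.
- exact: Jmap_mul.
- exact: Jmap_inv.
Qed.
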